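(* Let $X$ be a compact metric space and let $\phi$ be a continuous flow on $X$ with the oriented shadowing property. If $\Lambda\subset X$ is a compact and invariant set without singularities, then $\Lambda$ has the local standard shadowing property.
   Context: $(X,d)$ is a compact metric space and $\phi$ a continuous flow on $X$. A singularity is a point fixed by all $\phi_t$. For $\delta,T>0$, a $\delta$-$T$-pseudo-orbit is a sequence $P=(x_i,t_i)_{i\in\mathbb Z}$ with $x_i\in X$, $t_i\ge T$ and $d(\phi_{t_i}(x_i),x_{i+1})\le\delta$ for all $i$. Put $\mathcal P(P)=\bigcup_{i\in\mathbb Z}\phi_{[0,t_i]}(x_i)$, $S_0=0$, $S_i=\sum_{n=0}^{i-1}t_n$ for $i>0$, and $S_i=-\sum_{n=1}^{|i|}t_{-n}$ for $i<0$. $\mathrm{Rep}$ is the set of increasing homeomorphisms $h:\mathbb R\to\mathbb R$ with $h(0)=0$; for $\varepsilon>0$, $\mathrm{Rep}(\varepsilon)=\{h\in\mathrm{Rep}: |\frac{h(t)-h(s)}{t-s}-1|\le\varepsilon \text{ for all } t\ne s\}$. The pseudo-orbit is $\varepsilon$-traced by $x\in X$ if there is $h\in\mathrm{Rep}$ with $d(\phi_{t-S_i}(x_i),\phi_{h(t)}(x))\le\varepsilon$ for all $i\in\mathbb Z$ and $t\in[S_i,S_{i+1}]$; it is strongly $\varepsilon$-traced by $x$ if this holds with some $h\in\mathrm{Rep}(\varepsilon)$. The flow has the oriented shadowing property if for every $\varepsilon>0$ there is $\delta>0$ such that every $\delta$-$1$-pseudo-orbit is $\varepsilon$-traced by some point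 of $X$. A compact set $\Lambda$ has the local standard shadowing property if for every $\varepsilon>0$ and $T>0$ there are a neighborhood $U$ of $\Lambda$ and $\delta>0$ such that every $\delta$-$T$-pseudo-orbit $P$ with $\mathcal P(P)\subset U$ is strongly $\varepsilon$-traced by some point of $X$. *)

(* Defs.v *)
From HB Require Import structures.
From mathcomp Require Import all_boot all_order all_algebra.
From mathcomp Require Import all_classical all_reals topology normedtype.

Set Implicit Arguments.
Unset Strict Implicit.
Unset Printing Implicit Defensive.

Import Order.TTheory GRing.Theory Num.Theory.
Import numFieldNormedType.Exports.

Local Open Scope classical_set_scope.
Local Open Scope ring_scope.

(* Joint continuity on R * X is required, not just continuity of each phi t. *)
Definition continuous_flow (R : realType) (X : metricType R)
    (phi : R -> X -> X) : Prop :=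
  [/\ continuous (fun p : R * X => phi p.1 p.2),
      forall x, phi 0 x = x &
      forall s t x, phi (s + t) x = phi s (phi t x)].

Definition singularity (R : realType) (X : metricType R)
    (phi : R -> X -> X) (x : X) : Prop :=
  forall t, phi t x = x.

Definition invariant_set (R : realType) (X : metricType R)
    (phi : R -> X -> X) (L : set X) : Prop :=
  forall t, phi t @` L = L.

Definition pseudo_orbit (R : realType) (X : metricType R)
    (phi : R -> X -> X) (delta T : R) (P : int -> X * R) : Prop :=
  forall i : int,
    T <= (P i).2 /\ mdist (phi (P i).2 (P i).1) (P (i + 1)).1 <= delta.

Definition pseudo_orbit_set (R : realType) (X : metricType R)
    (phi : R -> X -> X) (P : int -> X * R) : set X :=
  \bigcup_(i in [set: int]) ((fun t => phi t (P i).1) @` `[0, (P i).2]).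

(* Negz n is the integer - (n + 1), so the second sum ranges over
   k = 1, ..., n + 1. *)
Definition pseudo_orbit_time (R : realType) (X : metricType R)
    (P : int -> X * R) (i : int) : R :=
  match i with
  | Posz n => \sum_(0 <= k < n) (P k%:Z).2
  | Negz n => - \sum_(1 <= k < n.+2) (P (- k%:Z)).2
  end.

Definition Rep (R : realType) (h : R -> R) : Prop :=
  [/\ continuous h,
      exists g : R -> R, [/\ continuous g, cancel h g & cancel g h],
      {homo h : s t / s < t} &
      h 0 = 0].

Definition Rep_near (R : realType) (eps : R) (h : R -> R) : Prop :=
  Rep h /\
  forall t s : R, t != s -> `|(h t - h s) / (t - s) - 1| <= eps.

Definition traces_with (R : realType) (X : metricType R)
    (phi : R -> X -> X) (P : int -> X * R) (eps : R) (x : X) (h : R -> R) :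
    Prop :=
  forall (i : int) (t : R),
    t \in `[pseudo_orbit_time P i, pseudo_orbit_time P (i + 1)] ->
    mdist (phi (t - pseudo_orbit_time P i) (P i).1) (phi (h t) x) <= eps.

Definition traced (R : realType) (X : metricType R)
    (phi : R -> X -> X) (P : int -> X * R) (eps : R) (x : X) : Prop :=
  exists2 h : R -> R, Rep h & traces_with phi P eps x h.

Definition strongly_traced (R : realType) (X : metricType R)
    (phi : R -> X -> X) (P : int -> X * R) (eps : R) (x : X) : Prop :=
  exists2 h : R -> R, Rep_near eps h & traces_with phi P eps x h.

Definition oriented_shadowing (R : realType) (X : metricType R)
    (phi : R -> X -> X) : Prop :=
  forall eps : R, 0 < eps ->
  exists2 delta : R, 0 < delta &
    forall P : int -> X * R, pseudo_orbit phi delta 1 P ->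
    exists x : X, traced phi P eps x.

Definition local_standard_shadowing (R : realType) (X : metricType R)
    (phi : R -> X -> X) (L : set X) : Prop :=
  forall eps T : R, 0 < eps -> 0 < T ->
  exists (U : set X) (delta : R),
    [/\ set_nbhs L U, 0 < delta &
        forall P : int -> X * R, pseudo_orbit phi delta T P ->
          pseudo_orbit_set phi P `<=` U ->
        exists x : X, strongly_traced phi P eps x].

(* Main.v *)
Require Import Defs.
From mathcomp Require Import all_boot all_order all_algebra.
From mathcomp Require Import all_classical all_reals topology normedtype.
From mathcomp Require Import ring lra.

(* Read the pseudo-orbit as a discontinuous curve psi on R.  Sampling psi at the
   integers turns a delta-T-pseudo-orbit into a pseudo-orbit with all times
   equal to 1, which oriented shadowing traces by a point x with some h.  Near L
   there are no fixed points of phi_c for small c > 0, which prevents h from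
   drifting by more than c from the identity over unit times.  Hence g = h - id
   satisfies |g t - g s| <= c + c |t - s|; its inf-convolution
   inf_s (g s + c |t - s|) is c-Lipschitz and within c of g, so id plus it (up to
   a constant) lies in Rep(c) and still traces. *)

Set Implicit Arguments.
Unset Strict Implicit.
Unset Printing Implicit Defensive.

Import Order.TTheory GRing.Theory Num.Theory.
Import numFieldNormedType.Exports.

Local Open Scope classical_set_scope.
Local Open Scope ring_scope.

(** * Uniform estimates for a flow on a compact space *)

(** Each local bound persists for all smaller [e], so it holds eventually along [0^'+];
    near-covering compactness then makes it uniform on [K]. *)
Lemma compact_uniform_gt0 (R : realType) (T : pseudoMetricType R) (K : set T)
    (P : R -> T -> Prop) :
  compact K ->
  (forall x, K x -> exists2 r : R, 0 < r &
     forall e y, 0 < e < r -> ball x r y -> P e y) ->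
  exists2 e, 0 < e & K `<=` P e.
Proof.
move=> /compact_near_coveringP /(_ R 0^'+ P _) cK Pr.
have PK : \forall e \near 0^'+, K `<=` P e.
  apply: cK => x /Pr[r r0 rP].
  exists (ball x r, [set e | 0 < e < r]) => /=; last first.
    by move=> [y e] /= [xy er]; exact: rP.
  split; first exact: nbhsx_ballx.
  by near=> e; apply/andP; split; near: e; [exact: nbhs_right_gt|exact: nbhs_right_lt].
near (0:R)^'+ => e; exists e.
  by near: e; exact: nbhs_right_gt.
by near: e; exact: PK.
Unshelve. all: end_near. Qed.

Section Flow.
Context (R : realType) (X : metricType R) (phi : R -> X -> X).
Hypothesis cX : compact [set: X].
Hypothesis flow : continuous_flow phi.

Local Notation d := (@mdist R X).

Lemma flow_continuous_dist t x e : 0 < e ->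
  exists2 r : R, 0 < r & forall s y, `|t - s| < r -> d x y < r ->
    d (phi t x) (phi s y) < e.
Proof.
case: flow => cphi _ _ e0.
have /nbhs_ballP[r /= r0 rP] := cphi (t, x) _ (nbhsx_ballx (phi t x) _ e0).
exists r => // s y ts xy; have := rP (s, y).
by rewrite /= ballEmdist; apply; split => //=; rewrite ballEmdist.
Qed.

Lemma flow_equicontinuous B e : 0 < e ->
  exists2 r : R, 0 < r & forall s x y, `|s| <= B -> d x y <= r ->
    d (phi s x) (phi s y) <= e.
Proof.
move=> e0; have cK := compact_setX (@segment_compact R (- B) B) cX.
have [|r r0 rP] := compact_uniform_gt0 (P := fun (r : R) (p : R * X) =>
  forall y, d p.2 y <= r -> d (phi p.1 p.2) (phi p.1 y) <= e) cK.
  move=> [t x] _; have [r r0 rP] := @flow_continuous_dist t x (e / 2) ltac:(lra).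
  (* Halved so that [z], close to [y], is still within [r] of the centre [x]. *)
  exists (r / 2); first by lra.
  move=> r' [s y] /= r'r [/= ts]; rewrite ballEmdist/= => xy z yz.
  have := metric_triangle (phi s y) (phi t x) (phi s z).
  have ts' : `|t - s| < r by apply: lt_trans ts _; lra.
  have := rP s y ts' ltac:(lra).
  have := rP s z ts' ltac:(have := metric_triangle x y z; lra).
  rewrite (metric_sym (phi s y) (phi t x)); lra.
exists r => // s x y; rewrite ler_norml => sB xy.
by apply: (rP (s, x)) => //; split; rewrite /= ?in_itv.
Qed.

Lemma flow_small_displacement e : 0 < e ->
  exists2 r : R, 0 < r & forall s x, `|s| <= r -> d (phi s x) x <= e.
Proof.
move=> e0; case: flow => _ phi0 _.
have [|r r0 rP] := compact_uniform_gt0 (P := fun (r : R) (x : X) =>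
  forall s, `|s| <= r -> d (phi s x) x <= e) cX.
  move=> x _; have [r r0 rP] := @flow_continuous_dist 0 x (e / 2) ltac:(lra).
  exists r => // r' y r'r; rewrite ballEmdist/= => xy s sr'.
  have := rP s y ltac:(rewrite sub0r normrN; lra) xy.
  have := rP 0 y ltac:(rewrite subrr normr0; lra) xy.
  rewrite !phi0 => h1 h2.
  have := metric_triangle (phi s y) x y; rewrite (metric_sym _ x); lra.
by exists r => // s x; exact: rP.
Qed.

Lemma flow_period_div c z : 0 < c -> phi c z = z ->
  forall t, exists2 r : R, 0 <= r < c & phi t z = phi r z.
Proof.
move=> c0 cz t; case: flow => _ phi0 phiD.
have kcn (n : nat) : phi (n%:R * c) z = z.
  elim: n => [|n IH]; first by rewrite mul0r phi0.
  by rewrite -natr1 mulrDl mul1r phiD cz.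
have kc (k : int) : phi (k%:~R * c) z = z.
  case: k => n; first exact: kcn.
  rewrite NegzE mulrNz mulNr -{1}(kcn n.+1) -phiD.
  by rewrite (addrC (- _)) subrr phi0.
pose k := Num.floor (t / c).
have /andP[k1 k2] := floor_itv (t / c).
exists (t - k%:~R * c).
  have : k%:~R * c <= t by rewrite -ler_pdivlMr.
  have : t < (k%:~R + 1) * c by rewrite -ltr_pdivrMr// -intrD1.
  lra.
by rewrite -{2}(kc k) -phiD subrK.
Qed.

(** By compactness there is one [m > 0] such that every point of [L] is moved by more than [m] at
    some time. Reduced modulo a small period, that time would be too short to move any point that
    far. *)
Lemma no_small_periods (L : set X) : compact L ->
  (forall x, L x -> ~ singularity phi x) ->
  exists2 r : R, 0 < r & forall c z, 0 < c <= r -> L z -> phi c z <> z.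
Proof.
move=> cL nL; case: (flow) => _ phi0 phiD.
have [|m m0 mP] := compact_uniform_gt0 (P := fun (m : R) (x : X) =>
  exists t, m < d (phi t x) x) cL.
  move=> x /nL /existsNP[t /eqP]; rewrite -mdist_gt0 => d0.
  set e := d _ _ in d0.
  have [r r0 rP] := @flow_continuous_dist t x (e / 4) ltac:(lra).
  exists (Num.min r (e / 4)); first by rewrite lt_min; apply/andP; split; lra.
  move=> m y; rewrite ballEmdist/= !lt_min => /andP[m0 /andP[mr me]] /andP[xr xe].
  exists t; have := rP t y ltac:(rewrite subrr normr0; lra) xr.
  have := metric_triangle (phi t x) (phi t y) x.
  have := metric_triangle (phi t y) y x; rewrite (metric_sym y) -/e; lra.
have [r r0 rP] := flow_small_displacement m0.
exists r => // c z /andP[c0 cr] /mP[t mt] cz.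
have [s /andP[s0 sc] ts] := flow_period_div c0 cz t.
by have := rP s z ltac:(rewrite ger0_norm; lra); rewrite -ts; lra.
Qed.

(** Both signs of time are wanted because a reparametrization may run ahead or lag behind. *)
Lemma displacement_nbhs (L : set X) c : compact L ->
  (forall z, L z -> phi c z <> z) ->
  exists (m : R) (U : set X), [/\ 0 < m, set_nbhs L U &
    forall w, U w -> m < d (phi c w) w /\ m < d (phi (- c) w) w].
Proof.
move=> cL nL; case: (flow) => _ phi0 phiD.
pose Q (m : R) w := m < d (phi c w) w /\ m < d (phi (- c) w) w.
have loc x : L x -> exists2 r : R, 0 < r &
    forall e y, 0 < e < r -> ball x r y -> Q e y.
  move=> /nL /eqP cx.
  have cx' : phi (- c) x != x.
    apply/eqP => h; move: cx; rewrite -{1}h -phiD subrr phi0.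
    by rewrite eqxx.
  move: cx cx'; rewrite -!mdist_gt0 => d1 d2.
  set e1 := d (phi c x) x in d1; set e2 := d _ _ in d2.
  have [r1 r10 rP1] := @flow_continuous_dist c x (e1 / 4) ltac:(lra).
  have [r2 r20 rP2] := @flow_continuous_dist (- c) x (e2 / 4) ltac:(lra).
  exists (Num.min (Num.min r1 (e1 / 4)) (Num.min r2 (e2 / 4))).
    by rewrite !lt_min; apply/andP; split; apply/andP; split; lra.
  move=> m y; rewrite ballEmdist/= !lt_min.
  move=> /andP[m0 /andP[/andP[? ?] /andP[? ?]]] /andP[/andP[? ?] /andP[? ?]].
  have := rP1 c y ltac:(rewrite subrr normr0; lra) ltac:(lra).
  have := rP2 (- c) y ltac:(rewrite subrr normr0; lra) ltac:(lra).
  have := metric_triangle (phi c x) (phi c y) x.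
  have := metric_triangle (phi c y) y x.
  have := metric_triangle (phi (- c) x) (phi (- c) y) x.
  have := metric_triangle (phi (- c) y) y x; rewrite (metric_sym y) -/e1 -/e2.
  by move=> *; split; lra.
have [m m0 mP] := compact_uniform_gt0 cL loc.
(* Replacing a point of [L] by a nearby one changes each displacement by less than [m / 4 + m / 4],
   so [m / 2] survives. *)
exists (m / 2), (Q (m / 2)); split => //; first by lra.
move=> x Lx.
have := mP x Lx; rewrite /Q => -[q1 q2].
have [r1 r10 rP1] := @flow_continuous_dist c x (m / 4) ltac:(lra).
have [r2 r20 rP2] := @flow_continuous_dist (- c) x (m / 4) ltac:(lra).
apply/nbhs_ballP; exists (Num.min (m / 4) (Num.min r1 r2)).
  by rewrite /= !lt_min; apply/andP; split; [lra|apply/andP].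
move=> y; rewrite ballEmdist/= !lt_min => /andP[xy /andP[xy1 xy2]].
have := rP1 c y ltac:(rewrite subrr normr0; lra) ltac:(lra).
have := rP2 (- c) y ltac:(rewrite subrr normr0; lra) ltac:(lra).
have := metric_triangle (phi c x) (phi c y) x.
have := metric_triangle (phi c y) y x.
have := metric_triangle (phi (- c) x) (phi (- c) y) x.
have := metric_triangle (phi (- c) y) y x; rewrite (metric_sym y).
by move=> *; split; lra.
Qed.

End Flow.

(** * Lipschitz functions and reparametrizations of the line *)

Lemma lipschitz_continuous_real (R : realType) (k : R) (f : R -> R) :
  (forall t s, `|f t - f s| <= k * `|t - s|) -> continuous f.
Proof.
move=> fk t; have k0 : 0 <= k.
  by have := fk 1 0; rewrite subr0 normr1; have := normr_ge0 (f 1 - f 0); lra.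
apply/(@cvgrPdist_lt _ R^o) => e e0.
(* Dividing by [k + 1] covers the case [k = 0]. *)
apply/nbhs_ballP; exists (e / (k + 1)); first by apply: divr_gt0; lra.
move=> s; rewrite /ball /= ltr_pdivlMr; last by lra.
by have := fk t s; have := normr_ge0 (t - s); nra.
Qed.

(** As [c < 1], the map contracts distances by a factor no smaller than [1 - c]: this gives
    injectivity, a Lipschitz inverse and, with intermediate values, surjectivity. Its difference
    quotient minus 1 is that of [g]. *)
Lemma lipschitz_perturbation_Rep_near (R : realType) (c : R) (g : R -> R) :
  c < 1 -> (forall t s, `|g t - g s| <= c * `|t - s|) -> g 0 = 0 ->
  Rep_near c (fun t => t + g t).
Proof.
move=> c1 gc g0; set h := fun t => t + g t.
have c0 : 0 <= c by have := gc 1 0; rewrite subr0 normr1; have := normr_ge0 (g 1 - g 0); lra.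
have hc : continuous h.
  apply: (@lipschitz_continuous_real _ (1 + c)) => t s.
  have -> : h t - h s = (t - s) + (g t - g s) by rewrite /h; ring.
  by apply: le_trans (ler_normD _ _) _; rewrite mulrDl mul1r lerD2l.
have hmono s t : s <= t -> (1 - c) * (t - s) <= h t - h s.
  move=> st; have := gc t s; rewrite (ger0_norm (x := t - s)); last by lra.
  by rewrite ler_norml => /andP[]; rewrite /h; lra.
have hexp t s : (1 - c) * `|t - s| <= `|h t - h s|.
  have [st|ts|->] := ltgtP s t; last by rewrite !subrr !normr0 mulr0.
    by have := hmono _ _ (ltW st); have := ler_norm (h t - h s); rewrite (gtr0_norm (x := t - s)); lra.
  by have := hmono _ _ (ltW ts); have := ler_norm (h s - h t); rewrite (distrC t) (distrC (h t)) (gtr0_norm (x := s - t)); lra.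
have hinj : injective h.
  move=> t s hts; have := hexp t s; rewrite hts subrr normr0 => h1.
  apply/eqP; rewrite -subr_eq0 -normr_le0; have := normr_ge0 (t - s); nra.
have hsurj y : exists t, h t = y.
  have h0 : h 0 = 0 by rewrite /h g0 addr0.
  pose b := `|y| / (1 - c).
  have b0 : 0 <= b by apply: divr_ge0; [exact: normr_ge0|lra].
  have bE : (1 - c) * b = `|y| by rewrite mulrC divfK //; apply/eqP; lra.
  have hb : `|y| <= h b by have := hmono _ _ b0; rewrite h0; lra.
  have hNb : h (- b) <= - `|y| by have := hmono (- b) 0 ltac:(lra); rewrite h0; lra.
  have := ler_norm y; have := ler_norm (- y); rewrite normrN => y1 y2.
  have [||//|t _ <-] := @IVT R h (- b) b y; last by exists t.
  - lra.
  - exact: continuous_subspaceT.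
  - by rewrite ge_min le_max; apply/andP; split; apply/orP; [left|right]; lra.
have [g' g'K] := choice hsurj.
split; last first.
  move=> t s; rewrite -subr_eq0 => ts.
  have -> : (h t - h s) / (t - s) - 1 = (g t - g s) / (t - s).
    by rewrite /h; field.
  by rewrite normrM normfV ler_pdivrMr ?normr_gt0.
split => //.
- exists g'; split => //; last by move=> t; apply: hinj; rewrite g'K.
  apply: (@lipschitz_continuous_real _ (1 - c)^-1) => t s.
  rewrite mulrC ler_pdivlMr; last by lra.
  by have := hexp (g' t) (g' s); rewrite !g'K mulrC.
- by move=> s t st; have := hmono _ _ (ltW st); nra.
- by rewrite /h g0 addr0.
Qed.

(** Cut the interval into unit steps and a last step of length at most 1: a unit step costs [c]
    times its length, the last one the additive [c]. *)
Lemma coarse_lipschitz (R : realType) (c : R) (g : R -> R) :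
  (forall t s, 0 <= s <= 1 -> `|g (t + s) - g t| <= c) ->
  forall t s, `|g t - g s| <= c + c * `|t - s|.
Proof.
move=> gc; have c0 : 0 <= c by apply: le_trans (gc 0 0 _) => //; lra.
have step (n : nat) t u : 0 <= u <= n%:R -> `|g (t + u) - g t| <= c + c * u.
  elim: n t u => [|n IH] t u.
    move=> u0; have {u0}-> : u = 0 by lra.
    by rewrite addr0 subrr normr0; lra.
  rewrite -natr1 => un; have [u1|u1] := leP u 1.
    by have := gc t u ltac:(lra); nra.
  have := IH (t + 1) (u - 1) ltac:(lra); have := gc t 1 ltac:(lra).
  have -> : t + 1 + (u - 1) = t + u by ring.
  have := ler_distD (g (t + 1)) (g (t + u)) (g t); lra.
have main t s : s <= t -> `|g t - g s| <= c + c * `|t - s|.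
  move=> st; have st0 : 0 <= t - s by lra.
  rewrite (ger0_norm st0).
  have := step (Num.truncn (t - s)).+1 s (t - s).
  rewrite (addrC s) subrK; apply; rewrite st0 /=.
  by apply/ltW; rewrite truncnS_gt.
move=> t s; have [st|/ltW ts] := leP s t; first exact: main.
by rewrite distrC (distrC t); exact: main.
Qed.

(** The hypothesis bounds every competitor in the inf-convolution below by [g t - c], so the infimum
    is finite; the competitor [s = t] gives [g' t <= g t]. An infimum of [c]-Lipschitz functions is
    [c]-Lipschitz. *)
Lemma lipschitz_regularization (R : realType) (c : R) (g : R -> R) :
  (forall t s, `|g t - g s| <= c + c * `|t - s|) ->
  exists g' : R -> R, (forall t s, `|g' t - g' s| <= c * `|t - s|) /\
    forall t, g' t <= g t <= g' t + c.
Proof.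
move=> gc; have c0 : 0 <= c by have := gc 0 0; rewrite !subrr normr0; lra.
pose E t := range (fun s => g s + c * `|t - s|).
have lbE t : lbound (E t) (g t - c).
  move=> _ [s _ <-]; have := gc t s; have := ler_norm (g t - g s); lra.
have hlE t : has_lbound (E t) by exists (g t - c).
have neE t : E t !=set0 by exists (g 0 + c * `|t - 0|), 0.
have half t s : inf (E t) - inf (E s) <= c * `|t - s|.
  rewrite lerBlDr -lerBlDl; apply: lb_le_inf => // _ [u _ <-].
  rewrite lerBlDl; apply: (@le_trans _ _ (g u + c * `|t - u|)).
    by apply: ge_inf => //; exists u.
  by have := ler_distD s t u; nra.
exists (fun t => inf (E t)); split=> t.
  by move=> s; rewrite ler_norml; apply/andP; split; have := half t s; have := half s t; rewrite (distrC s); lra.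
apply/andP; split.
  by apply: ge_inf => //; exists t => //; rewrite subrr normr0; lra.
by rewrite -lerBlDr; exact: lb_le_inf.
Qed.

(** * Starting times of the pieces of a pseudo-orbit *)

Section PseudoOrbitTime.
Context (R : realType) (X : metricType R) (P : int -> X * R).

Lemma pseudo_orbit_time0 : pseudo_orbit_time P 0 = 0.
Proof. by rewrite /pseudo_orbit_time /= big_geq. Qed.

Lemma pseudo_orbit_timeS i :
  pseudo_orbit_time P (i + 1) = pseudo_orbit_time P i + (P i).2.
Proof.
case: i => [n|[|n]].
- by rewrite -PoszD addn1 /= big_nat_recr.
- by rewrite /= big_nat1 big_geq // addNr.
(* Passing from [Negz n.+1] to [Negz n] removes the last summand, of index [n.+2]. *)
- have -> : Negz n.+1 + 1 = Negz n by rewrite !NegzE -addn1 PoszD opprD subrK.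
  by rewrite /= (big_nat_recr n.+2) //= opprD -addrA addNr addr0.
Qed.

Lemma pseudo_orbit_time_lin T :
  (forall i, T <= (P i).2) -> forall i (n : nat),
  pseudo_orbit_time P i + n%:R * T <= pseudo_orbit_time P (i + n%:Z).
Proof.
move=> PT i; elim=> [|n IH]; first by rewrite addr0; lra.
rewrite -natr1 -(addn1 n) PoszD addrA pseudo_orbit_timeS.
by have := PT (i + n%:Z); lra.
Qed.

Lemma pseudo_orbit_time_unit : (forall i, (P i).2 = 1) ->
  forall i, pseudo_orbit_time P i = i%:~R.
Proof.
move=> P1; have SS i : pseudo_orbit_time P (i + 1) = pseudo_orbit_time P i + 1.
  by rewrite pseudo_orbit_timeS P1.
case=> n.
  elim: n => [|n IH]; first exact: pseudo_orbit_time0.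
  by rewrite -addn1 PoszD SS IH -intrD1.
elim: n => [|n IH].
  by have := SS (Negz 0); rewrite pseudo_orbit_time0 NegzE mulrNz; lra.
have := SS (Negz n.+1).
have <- : Negz n = Negz n.+1 + 1 by rewrite !NegzE -(addn1 n.+1) PoszD opprD subrK.
by rewrite IH !NegzE !mulrNz -!pmulrn -[in X in _ -> _ = - X]natr1; lra.
Qed.

(** Times grow at least linearly in both directions, so piece [- N] starts before [t] and some later
    piece after it; the wanted piece precedes the first such one. *)
Lemma pseudo_orbit_time_locate T : 0 < T -> (forall i, T <= (P i).2) ->
  forall t, exists i, pseudo_orbit_time P i <= t < pseudo_orbit_time P (i + 1).
Proof.
move=> T0 PT t; pose N := (Num.truncn (`|t| / T)).+1.
have tN : `|t| < N%:R * T.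
  by rewrite -ltr_pdivrMr // truncnS_gt.
have lo : pseudo_orbit_time P (- N%:Z) <= t.
  have := pseudo_orbit_time_lin PT (- N%:Z) N; rewrite addNr pseudo_orbit_time0.
  by have := ler_norm (- t); rewrite normrN; lra.
have ex : exists n : nat, t < pseudo_orbit_time P (- N%:Z + n%:Z).
  exists (N + N)%N; rewrite PoszD addrA addNr.
  have := pseudo_orbit_time_lin PT 0 N; rewrite pseudo_orbit_time0.
  by have := ler_norm t; lra.
case: (ex_minnP ex) => -[|n] nt nmin.
  by move: nt; rewrite addr0 ltNge lo.
exists (- N%:Z + n%:Z); rewrite -addrA -PoszD addn1 nt andbT leNgt.
by apply/negP => /nmin; rewrite ltnn.
Qed.

End PseudoOrbitTime.

Lemma pseudo_orbit_time_lt_reflect (R : realType) (X : metricType R)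
    (P : int -> X * R) T : 0 <= T -> (forall i, T <= (P i).2) ->
  forall i j, pseudo_orbit_time P i < pseudo_orbit_time P j -> i < j.
Proof.
move=> T0 PT i j; rewrite !ltNge; apply: contraNN => ji.
have -> : i = j + `|i - j|%N%:Z by rewrite gez0_abs ?subr_ge0 // subrKC.
apply: le_trans (pseudo_orbit_time_lin PT _ _).
by rewrite lerDl mulr_ge0.
Qed.

(** * Comparing pseudo-orbits with true orbits *)

Section Tracing.
Context (R : realType) (X : metricType R) (phi : R -> X -> X).
Hypothesis cX : compact [set: X].
Hypothesis flow : continuous_flow phi.

Local Notation d := (@mdist R X).

(* By the intermediate value theorem a drift larger than c passes through +- c,
   at a time where the trace of z := psi (t + s) is close to both z and
   phi (+- c) z, against the displacement bound m on U. *)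
Lemma tracing_time_drift c m (U : set X) : 0 < c <= 1 -> 0 < m ->
  (forall w, U w -> m < d (phi c w) w /\ m < d (phi (- c) w) w) ->
  exists2 r : R, 0 < r & forall (psi : R -> X) (h : R -> R) x,
    continuous h -> (forall t, U (psi t)) ->
    (forall t s, 0 <= s <= 1 -> d (phi s (psi t)) (psi (t + s)) <= r) ->
    (forall t, d (psi t) (phi (h t) x) <= r) ->
    forall t s, 0 <= s <= 1 -> `|h (t + s) - h t - s| <= c.
Proof.
move=> /andP[c0 c1] m0 mU; case: (flow) => _ _ phiD.
(* Constants are chosen backwards: [phi b] with [|b| = c] takes [r2]-close points to [m / 2]-close
   ones, and [phi u] with [u] in [0, 1] takes [r1]-close points to [r2 / 2]-close ones. *)
have [r2 r20 rP2] := @flow_equicontinuous _ _ _ cX flow 1 (m / 2) ltac:(lra).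
have [r1 r10 rP1] := @flow_equicontinuous _ _ _ cX flow 1 (r2 / 2) ltac:(lra).
exists (Num.min r1 (Num.min (r2 / 2) (m / 2))).
  by rewrite !lt_min; apply/andP; split; [lra|apply/andP; split; lra].
move=> psi h x ch Upsi; set r := Num.min _ _ => psi1 hpsi t s s01.
have [rr1 rr2 rm] : [/\ r <= r1, r <= r2 / 2 & r <= m / 2].
  by split; rewrite /r !ge_min lexx ?orbT.
have no_drift b u : `|b| = c -> 0 <= u <= 1 -> h (t + u) - h t - u <> b.
  move=> bc u01 hb.
  have htu : h (t + u) = b + (u + h t) by lra.
  (* [phi u (phi (h t) x)] is [r2]-close to [psi (t + u)]: half from tracing at [t], half from the
     defect of [psi]. Applying [phi b] costs [m / 2], tracing at [t + u] another [m / 2]. *)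
  have bz : d (phi b (psi (t + u))) (psi (t + u)) <= m.
    have := hpsi (t + u); rewrite htu !phiD => h1.
    have := rP1 u (psi t) (phi (h t) x) ltac:(rewrite ger0_norm; lra) (le_trans (hpsi t) rr1).
    have := psi1 t u u01; rewrite metric_sym => h2 h3.
    have h4 := metric_triangle (psi (t + u)) (phi u (psi t)) (phi u (phi (h t) x)).
    have := rP2 b _ _ ltac:(lra) (ltac:(lra) : d (psi (t + u)) (phi u (phi (h t) x)) <= r2).
    have := metric_triangle (phi b (psi (t + u))) (phi b (phi u (phi (h t) x))) (psi (t + u)).
    by rewrite (metric_sym (phi b (phi u _)) (psi _)); lra.
  have [mc mNc] := mU _ (Upsi (t + u)).
  have [b0|b0] := leP 0 b.
    by move: bz; rewrite -(ger0_norm b0) bc; lra.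
  have : b = - c by rewrite -bc ltr0_norm // opprK.
  by move=> bE; move: bz; rewrite bE; lra.
pose f u := h (t + u) - h t - u.
have f0 : f 0 = 0 by rewrite /f addr0; lra.
have cf : {within `[0, s], continuous f}.
  apply: continuous_subspaceT => u; rewrite /continuous_at /f.
  apply: cvgB; last exact: cvg_id.
  apply: cvgB; last exact: cvg_cst.
  apply: (@continuous_comp _ _ _ (fun v => t + v) h); last exact: ch.
  by apply: cvgD; [exact: cvg_cst|exact: cvg_id].
have s0 : 0 <= s by lra.
rewrite leNgt; apply/negP => cs.
have [b [bc fb]] : exists b, `|b| = c /\
    Num.min (f 0) (f s) <= b <= Num.max (f 0) (f s).
  move: cs; rewrite -/(f s) f0.
  have [fs|fs] := leP 0 (f s); [rewrite ger0_norm //|rewrite ltr0_norm //] => cs.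
    by exists c; rewrite (gtr0_norm c0); split => //; lra.
  by exists (- c); rewrite normrN (gtr0_norm c0); split => //; lra.
have [u us fu] := IVT s0 cf fb.
by move: us; rewrite in_itv /= => us; apply: (no_drift _ _ bc _ fu); lra.
Qed.

(** Pieces last at least [T], so a time [s <= 1] meets a bounded number of jumps, and equicontinuity
    controls how the flow propagates each. The endpoint [u = (P i).2] is allowed so that tracing can
    be checked at the right end of a piece. *)
Lemma pseudo_orbit_flow_close T e : 0 < T -> 0 < e ->
  exists2 delta : R, 0 < delta & forall P, pseudo_orbit phi delta T P ->
    forall i j u v s, i <= j -> 0 <= u <= (P i).2 -> 0 <= v -> 0 <= s <= 1 ->
    pseudo_orbit_time P i + u + s = pseudo_orbit_time P j + v ->
    d (phi s (phi u (P i).1)) (phi v (P j).1) <= e.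
Proof.
move=> T0; case: (flow) => _ _ phiD.
(* Induction on a bound for the number of jumps; [e] is quantified inside because the inductive step
   calls it at [r / 2]. *)
have step (N : nat) : forall e, 0 < e -> exists2 delta : R, 0 < delta &
    forall P, pseudo_orbit phi delta T P ->
    forall i (n : nat) u v s, (n <= N)%N ->
    0 <= u <= (P i).2 -> 0 <= v -> 0 <= s <= 1 ->
    pseudo_orbit_time P i + u + s = pseudo_orbit_time P (i + n%:Z) + v ->
    d (phi s (phi u (P i).1)) (phi v (P (i + n%:Z)).1) <= e.
  have base P i u v s : pseudo_orbit_time P i + u + s = pseudo_orbit_time P (i + 0) + v ->
      d (phi s (phi u (P i).1)) (phi v (P (i + 0)).1) = 0.
    rewrite addr0 => h; have -> : v = s + u by lra.
    by rewrite phiD mdistxx.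
  elim: N => [|N IH] {}e e0.
    exists 1 => // P _ i n u v s; rewrite leqn0 => /eqP -> _ _ _ /base ->.
    exact: ltW.
  have [r r0 rP] := @flow_equicontinuous _ _ _ cX flow 1 e e0.
  have [delta delta0 deltaP] := IH (r / 2) ltac:(lra).
  exists (Num.min delta (r / 2)); first by rewrite lt_min delta0; lra.
  move=> P Pd i [|n] u v s nN u0 v0 s01 hS.
    by rewrite (base _ _ _ _ _ hS) ltW.
  have Pd' : pseudo_orbit phi delta T P.
    move=> k; have [Tk dk] := Pd k; split=> //.
    by apply: le_trans dk _; rewrite ge_min lexx.
  set k := i + n%:Z; have kE : i + n.+1%:Z = k + 1 by rewrite /k -addn1 PoszD addrA.
  have [Tk] := Pd k; rewrite -kE le_min => /andP[_ dk].
  have Sk := pseudo_orbit_timeS P k; rewrite -kE in Sk.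
  (* Piece [i] ends no earlier than [u] and the pieces in between take nonnegative time, so [v] is
     part of [s]. *)
  have vs : v <= s.
    have := @pseudo_orbit_time_lin _ _ P 0 (fun i => le_trans (ltW T0) (proj1 (Pd i))) (i + 1) n.
    rewrite mulr0 -addrA -PoszD add1n pseudo_orbit_timeS; lra.
  (* Compare at the end of piece [k], just before the last jump. This error and the jump are at most
     [r / 2] each; then flow for time [v <= 1]. *)
  have := deltaP P Pd' i n u (P k).2 (s - v) nN u0 ltac:(lra) ltac:(lra) ltac:(lra).
  rewrite -/k => h1.
  have := metric_triangle (phi (s - v) (phi u (P i).1)) (phi (P k).2 (P k).1) (P (i + n.+1%:Z)).1.
  move=> h2.
  have := rP v _ _ ltac:(rewrite ger0_norm; lra) (ltac:(lra) : d (phi (s - v) (phi u (P i).1)) (P (i + n.+1%:Z)).1 <= r).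
  by rewrite -phiD (addrC v) subrK.
move=> e0; pose N := (Num.truncn (1 / T)).+1.
have TN : 1 < N%:R * T by rewrite -ltr_pdivrMr // truncnS_gt.
have [delta delta0 deltaP] := step N e e0.
exists delta => // P Pd i j u v s ij u0 v0 s01.
have -> : j = i + `|j - i|%N%:Z by rewrite gez0_abs ?subr_ge0 // subrKC.
move: `|j - i|%N => n hS; apply: deltaP => //.
case: n hS => // n hS; rewrite leqNgt; apply/negP => Nn.
(* Meeting [n.+1] jumps means crossing [n] full pieces, so [N <= n] would force [s > 1]. *)
have := pseudo_orbit_time_lin (fun i => proj1 (Pd i)) (i + 1) n.
rewrite -addrA -PoszD add1n pseudo_orbit_timeS.
have : N%:R * T <= n%:R * T by rewrite ler_pM2r // ler_nat.
lra.
Qed.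

End Tracing.

(** * From oriented to local standard shadowing *)

Theorem corollary4p5 (R : realType) (X : metricType R) (phi : R -> X -> X)
    (L : set X) :
  compact [set: X] ->
  continuous_flow phi ->
  oriented_shadowing phi ->
  compact L ->
  invariant_set phi L ->
  (forall x : X, L x -> ~ singularity phi x) ->
  local_standard_shadowing phi L.
Proof.
move=> cX flow shadow cL _ nsing eps T eps0 T0.
have phiD : forall s t x, phi (s + t) x = phi s (phi t x) by case: flow.
have phi0 : forall x, phi 0 x = x by case: flow.
have [r0 r00 rP0] := @flow_small_displacement _ _ _ cX flow (eps / 4) ltac:(lra).
have [p p0 pP] := no_small_periods cX flow cL nsing.
(* Respectively: membership in Rep([eps]), the bound [c < 1], a time correction costing at most
   [eps / 4], and no period [c] on [L]. *)
pose c := Num.min (Num.min eps (1 / 2)) (Num.min r0 p).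
have c0 : 0 < c.
  by rewrite !lt_min; apply/andP; split; apply/andP; split; lra.
have [ceps c12 cr0 cp] : [/\ c <= eps, c <= 1 / 2, c <= r0 & c <= p].
  by split; rewrite /c !ge_min lexx ?orbT.
have [|m [U [m0 LU mU]]] := @displacement_nbhs _ _ _ flow L c cL.
  by move=> z; apply: pP; rewrite c0.
have [r1 r10 driftP] := tracing_time_drift cX flow (c := c) ltac:(lra) m0 mU.
pose r := Num.min r1 (eps / 4).
have rr0 : 0 < r by rewrite lt_min r10; lra.
have [rr1 re] : r <= r1 /\ r <= eps / 4 by split; rewrite /r ge_min lexx ?orbT.
have [delta0 delta00 shadowP] := shadow (r / 2) ltac:(lra).
(* [delta0] makes the integer samples traceable; [r / 2] is the loss allowed between consecutive
   integers. *)
pose nu := Num.min delta0 (r / 2).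
have nu0 : 0 < nu by rewrite lt_min delta00; lra.
have [nud nur] : nu <= delta0 /\ nu <= r / 2.
  by split; rewrite /nu ge_min lexx ?orbT.
have [delta delta_gt0 deltaP] := pseudo_orbit_flow_close cX flow T0 nu0.
exists U, delta; split => // P Pd PU.
have PT i : T <= (P i).2 := proj1 (Pd i).
pose S := pseudo_orbit_time P.
have [idx idxP] := choice (pseudo_orbit_time_locate T0 PT).
have idx_le i t : S i <= t -> i <= idx t.
  move=> it; rewrite -ltzD1.
  apply: (pseudo_orbit_time_lt_reflect (ltW T0) PT).
  by have /andP[_] := idxP t; exact: le_lt_trans.
have idxS t : 0 <= t - S (idx t) <= (P (idx t)).2.
  have := idxP t; rewrite pseudo_orbit_timeS -/S; lra.
pose psi t := phi (t - S (idx t)) (P (idx t)).1.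
have Upsi t : U (psi t).
  by apply: PU; exists (idx t) => //; exists (t - S (idx t)); rewrite //= in_itv; exact: idxS.
have psi_flow t s : 0 <= s <= 1 -> mdist (phi s (psi t)) (psi (t + s)) <= nu.
  move=> s01; apply: deltaP => //.
  - by apply: idx_le; have := idxS t; lra.
  - by have := idxS (t + s); lra.
  - by rewrite -/S; lra.
(* At [t = S (i + 1)] the curve [psi] has already jumped to a later piece, hence a comparison with
   [s = 0]. *)
have psi_orbit i t : S i <= t <= S (i + 1) ->
    mdist (phi (t - S i) (P i).1) (psi t) <= nu.
  rewrite {1 2}/S pseudo_orbit_timeS -/S => it.
  have := deltaP P Pd i (idx t) (t - S i) (t - S (idx t)) 0.
  rewrite phi0; apply; rewrite -/S; try lra.
  - by apply: idx_le; lra.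
  - by have := idxS t; lra.
have [x [h [ch _ _ h0] hx]] : exists x, traced phi (fun i => (psi i%:~R, 1)) (r / 2) x.
  apply: shadowP => i; split => //=.
  by rewrite intrD1; apply: le_trans nud; apply: psi_flow; lra.
have psi_h t : mdist (psi t) (phi (h t) x) <= r.
  pose k := Num.floor t.
  have /andP[k1 k2] := floor_itv t; rewrite -/k intrD1 in k1 k2.
  have := hx k t; rewrite !pseudo_orbit_time_unit // in_itv /= intrD1 => /(_ ltac:(lra)) h1.
  have := psi_flow k%:~R (t - k%:~R) ltac:(lra).
  rewrite (addrC k%:~R) subrK metric_sym => h2.
  by have := metric_triangle (psi t) (phi (t - k%:~R) (psi k%:~R)) (phi (h t) x); lra.
have drift := driftP psi h x ch Upsi _ _.
pose g t := h t - t.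
have gc t s : 0 <= s <= 1 -> `|g (t + s) - g t| <= c.
  move=> s01; have -> : g (t + s) - g t = h (t + s) - h t - s by rewrite /g; ring.
  apply: drift => // [t' s' s'01|t'].
    by have := psi_flow t' s' s'01; lra.
  by have := psi_h t'; lra.
have [g' [g'lip g'g]] := lipschitz_regularization (coarse_lipschitz gc).
(* Subtracting [g' 0] makes the reparametrization fix 0. *)
have Rh : Rep_near c (fun t => t + (g' t - g' 0)).
  apply: lipschitz_perturbation_Rep_near; [lra| |exact: subrr].
  by move=> t s; rewrite opprB addrA subrK.
exists x, (fun t => t + (g' t - g' 0)).
  case: Rh => Rh1 Rh2; split => // t s ts; exact: le_trans (Rh2 t s ts) ceps.
move=> i t; rewrite in_itv /= -/(S i) -/(S (i + 1)) => it.
set ht := t + (g' t - _).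
(* [g - g'] lies in [0, [c]] at both [t] and 0, and [g 0 = 0], so the one-sided bounds give [c] and
   not [2 * c]. *)
have hth : `|ht - h t| <= r0.
  have := g'g t; have := g'g 0; rewrite /g /ht h0 ler_norml => a1 a2.
  by apply/andP; split; lra.
have := rP0 (ht - h t) (phi (h t) x) hth; rewrite -phiD subrK => h1.
have h2 := psi_orbit i t it; have h3 := psi_h t.
(* The total error [nu + r + eps / 4] is below [eps], since [nu <= r / 2] and [r <= eps / 4]. *)
have h4 := metric_triangle (phi (t - S i) (P i).1) (psi t) (phi (h t) x).
have := metric_triangle (phi (t - S i) (P i).1) (phi (h t) x) (phi ht x).
by rewrite (metric_sym (phi (h t) x)); lra.
Qed.
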